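(* Let $G$ be the pineapple graph $K_m^n$ with $n\geq 2$ and $m\geq 3$. Then $F_d(G)=m+n-2$.
   Context: The pineapple graph $K_m^n$ ($m\geq 3$, $n\geq 2$) is formed by coalescing (identifying) a vertex of the complete graph $K_m$ with the center (the vertex of degree $n$) of the star graph $K_{1,n}$; it has $m+n$ vertices and $\frac{m^2-m+2n}{2}$ edges, and the identified vertex has degree $m+n-1$. Zero forcing: given a set $B\subseteq V(G)$ of initially black vertices (all others white) of a finite simple graph $G$, at each step a black vertex having exactly one white neighbor forces that neighbor to become black; $B$ is a zero forcing set of $G$ if repeated application of this rule turns all vertices black. A set $D\subseteq V(G)$ is dominating if every vertex of $G$ is in $D$ or adjacent to a vertex of $D$. A dom-forcing set of $G$ is a set $D_f\subseteq V(G)$ that is both a dominating set of $G$ and a zero forcing set of $G$; the dom-forcing number $F_d(G)$ is the minimum cardinality of a dom-forcing set. *)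

(* Defs.v *)
From mathcomp Require Import all_boot.

Set Implicit Arguments.
Unset Strict Implicit.
Unset Printing Implicit Defensive.

(* Finite simple graphs. *)
Record sgraph := SGraph {
  vertex :> finType;
  adj : rel vertex;
  adj_sym : symmetric adj;
  adj_irr : irreflexive adj
}.

Section ZeroForcing.
Variable G : sgraph.
Implicit Types (B C D : {set G}) (u w : G).

Definition nbh u : {set G} := [set w | adj u w].

(* One force: B is the set of black vertices before it, C the set after it. *)
Definition force_step : rel {set G} := fun B C =>
  [exists u in B, exists w, (nbh u :\: B == [set w]) && (C == w |: B)].

(* [connect] is the reflexive transitive closure. *)
Definition zero_forcing B : bool := connect force_step B [set: G].

Definition dominating D : bool :=
  [forall w, (w \in D) || [exists u in D, adj u w]].

Definition dom_forcing D : bool := dominating D && zero_forcing D.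

Lemma dom_forcing_setT : dom_forcing [set: G].
Proof.
rewrite /dom_forcing /zero_forcing connect0 andbT.
by apply/forallP=> w; rewrite inE.
Qed.

(* The default value [set: G] of the minimization is itself a dom-forcing set
   by [dom_forcing_setT], so the minimum is genuine. *)
Definition dom_forcing_number : nat :=
  #|[arg min_(D < [set: G] | dom_forcing D) #|D| ]|.

End ZeroForcing.

Section Complete.
Variable m : nat.

Definition complete_adj : rel 'I_m := fun x y => x != y.

Lemma complete_adj_sym : symmetric complete_adj.
Proof. by move=> x y; rewrite /complete_adj eq_sym. Qed.

Lemma complete_adj_irr : irreflexive complete_adj.
Proof. by move=> x; rewrite /complete_adj eqxx. Qed.

Definition complete_graph : sgraph := SGraph complete_adj_sym complete_adj_irr.

End Complete.

(* The star K_{1,n}: its center is None and its leaves are the Some i. *)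
Section Star.
Variable n : nat.

Definition star_adj : rel (option 'I_n) := fun x y => isSome x != isSome y.

Lemma star_adj_sym : symmetric star_adj.
Proof. by move=> x y; rewrite /star_adj eq_sym. Qed.

Lemma star_adj_irr : irreflexive star_adj.
Proof. by move=> x; rewrite /star_adj eqxx. Qed.

Definition star_graph : sgraph := SGraph star_adj_sym star_adj_irr.

Definition star_center : star_graph := None.

End Star.

(* The coalescence of G1 and G2 identifying v1 with v2: the vertex v2 is
   removed from G2, and inl v1 plays the role of the identified vertex. *)
Section Coalescence.
Variables (G1 G2 : sgraph) (v1 : G1) (v2 : G2).

Definition coalescence_vertex : finType := (G1 + {y : G2 | y != v2})%type.

Definition coalescence_adj : rel coalescence_vertex := fun x y =>
  match x, y with
  | inl x1, inl y1 => adj x1 y1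
  | inr x2, inr y2 => adj (val x2) (val y2)
  | inl x1, inr y2 => (x1 == v1) && adj v2 (val y2)
  | inr x2, inl y1 => (y1 == v1) && adj v2 (val x2)
  end.

Lemma coalescence_adj_sym : symmetric coalescence_adj.
Proof. by case=> x [] y //=; apply: adj_sym. Qed.

Lemma coalescence_adj_irr : irreflexive coalescence_adj.
Proof. by case=> x /=; apply: adj_irr. Qed.

Definition coalescence : sgraph :=
  SGraph coalescence_adj_sym coalescence_adj_irr.

End Coalescence.

(* The pineapple graph K_m^n, with the star attached at the vertex v of K_m. *)
Definition pineapple (m n : nat) (v : 'I_m) : sgraph :=
  coalescence (v : complete_graph m) (star_center n).

Arguments pineapple : clear implicits.

(* Main.v *)
(* Two vertices with the same neighbours outside the pair cannot both be white
   in a zero forcing set, since no black vertex can force one before the other.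
   So at most one leaf and at most one non-central clique vertex are missing
   from a dom-forcing set, and if the center is missing then domination requires
   all leaves: at most two vertices are missing.  Conversely, the complement of
   one leaf and one non-central clique vertex is dom-forcing: another clique
   vertex forces the latter, then the center forces the former. *)
Require Import Defs.
From mathcomp Require Import all_boot.

Lemma force_stepI (G : sgraph) (B : {set G}) (u w : G) :
    u \in B -> adj u w -> w \notin B ->
    (forall z, adj u z -> z != w -> z \in B) ->
  force_step B (w |: B).
Proof.
move=> uB uw wB forced; apply/existsP; exists u; rewrite uB /=.
apply/existsP; exists w; rewrite eqxx andbT; apply/eqP/setP=> z.
rewrite !inE; have [->|zw] := eqVneq z w; first by rewrite wB uw.
by case uz: (adj u z); rewrite ?andbF // (forced z uz zw).
Qed.

Lemma zero_forcing_twins (G : sgraph) (B : {set G}) (x y : G) :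
    (forall u, u != x -> u != y -> adj u x = adj u y) ->
  zero_forcing B -> x != y -> (x \in B) || (y \in B).
Proof.
move=> twin /connectP[p Bp BpT] xy.
elim: p B Bp BpT => [|C p IHp] B /=; first by move=> _ <-; rewrite !inE.
case/andP=> /existsP[u /andP[uB /existsP[w /andP[/eqP uw /eqP defC]]]] Cp CpT.
(* By contraposition: if [x] and [y] are both white in [B], they stay white in [C]. *)
apply: contraLR (IHp C Cp CpT); rewrite !negb_or => /andP[xB yB].
have ux : u != x by apply: contraNneq xB => <-.
have uy : u != y by apply: contraNneq yB => <-.
(* The black [u] sees both of [x], [y] or neither, so the set [[set w]] of its white neighbours
   contains both or neither; both is excluded by [x != y]. *)
have eqw : (x == w) = (y == w).
  have := in_set1 x w; have := in_set1 y w.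
  by rewrite -uw !in_setD !inE xB yB (twin u ux uy) => -> ->.
have xw : x != w.
  by apply: contraNneq xy => xw; move: eqw; rewrite xw eqxx => /esym/eqP->.
have yw : y != w by rewrite -eqw.
by rewrite defC !in_setU1 (negPf xB) (negPf yB) !orbF xw yw.
Qed.

Lemma dom_forcing_number_eq (G : sgraph) (D0 : {set G}) (k : nat) :
    dom_forcing D0 -> #|D0| = k ->
    (forall D : {set G}, dom_forcing D -> k <= #|D|) ->
  dom_forcing_number G = k.
Proof.
move=> D0_df D0k lb; rewrite /dom_forcing_number.
case: arg_minnP => [|D D_df minD]; first exact: dom_forcing_setT.
by apply/eqP; rewrite eqn_leq lb // -D0k minD.
Qed.

Lemma card_pineapple (m n : nat) (v : 'I_m) : #|pineapple m n v| = m + n.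
Proof.
rewrite card_sum card_ord card_sig; congr (_ + _).
by rewrite (cardC1 (star_center n)) card_option card_ord.
Qed.

Lemma pineapple_card_setC (m n : nat) (v : 'I_m) (D : {set pineapple m n v}) :
  dom_forcing D -> #|~: D| <= 2.
Proof.
case/andP=> /forallP domD zfD.
(* Two classes: non-central clique vertices, and the leaves together with the center. Each class
   misses [D] at most once: by twins, or by [center_leaf] for a leaf and the center. *)
pose f (z : pineapple m n v) := if z is inl x then x == v else true.
suff f_inj : {in ~: D &, injective f}.
  by rewrite -card_bool -(card_in_imset f_inj) max_card.
have center_leaf : inl v \notin D -> forall l, inr l \in D.
  move=> vD l; have /orP[//|/existsP[[x|k] /= /andP[xD]]] := domD (inr l).
    by case/andP=> /eqP xv; rewrite -xv xD in vD.
  by case: k l {xD} => [[k|] //= _] [[l|] //= _].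
have twins x y : (forall u, u != x -> u != y -> adj u x = adj u y) ->
    x \in ~: D -> y \in ~: D -> x = y.
  move=> twin; rewrite !inE => xD yD; apply/eqP; apply: contraTT zfD => xy.
  apply/negP=> /(zero_forcing_twins _ _ _ _ twin)/(_ xy).
  by rewrite (negPf xD) (negPf yD).
case=> [x|k] [y|l] Dx Dy /= fxy.
- have [xv|xv] := eqVneq x v; first by move: fxy; rewrite xv eqxx => /esym/eqP->.
  have yv : y != v by rewrite -fxy.
  apply: twins => // -[u|u] /= ux uy; last by rewrite (negPf xv) (negPf yv).
  by rewrite /complete_adj ux uy.
- by move: Dx Dy; rewrite !inE (eqP fxy) => vD; rewrite (center_leaf vD).
- by move: Dx Dy; rewrite !inE (eqP (esym fxy)) => + vD; rewrite (center_leaf vD).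
- apply: twins => // -[u|u] _ _ /=.
    by case: k l {Dx Dy fxy} => [[k|] //= _] [[l|] //= _].
  by case: k l u {Dx Dy fxy} => [[k|] //= _] [[l|] //= _] [[u|] //= _].
Qed.

Lemma pineapple_dom_forcing (m n : nat) (v x u : 'I_m)
    (l : {y : star_graph n | y != star_center n}) :
    x != v -> u != v -> u != x ->
  dom_forcing (~: [set (inl x : pineapple m n v); inr l]).
Proof.
move=> xv uv ux; set D := ~: _.
have uD : inl u \in D by rewrite !inE negb_or; apply/andP.
have vD : inl v \in D by rewrite eq_sym in xv; rewrite !inE negb_or; apply/andP.
have vl : adj (inl v : pineapple m n v) (inr l).
  by rewrite /= eqxx; case: l {D uD vD} => [[l|]].
apply/andP; split.
  apply/forallP=> w; rewrite !inE -implybE; apply/implyP=> /orP[]/eqP->.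
    by apply/existsP; exists (inl u); rewrite uD.
  by apply/existsP; exists (inl v); rewrite vD.
(* The order matters: the center sees both white vertices until [x] turns black, whereas [u] sees no
   leaf. *)
apply: (@connect_trans _ _ (inl x |: D)); apply: connect1.
  apply: (force_stepI (pineapple m n v) _ (inl u)) => //; first by rewrite !inE eqxx.
  by case=> [z|k] /=; rewrite ?(negPf uv) // !inE orbF.
have -> : [set: pineapple m n v] = inr l |: (inl x |: D).
  by apply/setP=> z; rewrite !inE; case: (z == inl x); case: (z == inr l).
apply: (force_stepI (pineapple m n v) _ (inl v)) => //; first by rewrite in_setU1 vD orbT.
  by rewrite !inE eqxx.
by move=> z _ zl; rewrite !inE (negPf zl) orbF orbN.
Qed.

Theorem theorem3p12 (m n : nat) (v : 'I_m) (hm : 3 <= m) (hn : 2 <= n) :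
  dom_forcing_number (pineapple m n v) = m + n - 2.
Proof.
(* Since [m >= 3], there are two non-central clique vertices: [x] to leave white and [u] to force
   it. *)
have /card_gt1P[x [u [xv uv xu]]] : 1 < #|[set~ v]|.
  by rewrite cardsC1 card_ord; case: m hm {v} => [|[|[]]].
rewrite !inE in xv uv; rewrite eq_sym in xu.
(* The white leaf has index 0, in range because [ltnW hn] proves [0 < n]. *)
pose l : {y : star_graph n | y != star_center n} :=
  exist _ (Some (Ordinal (ltnW hn))) isT.
apply: (dom_forcing_number_eq _ _ _ (pineapple_dom_forcing m n v x u l xv uv xu)).
  by rewrite cardsCs setCK cards2 card_pineapple.
move=> D /pineapple_card_setC; rewrite -(card_pineapple m n v) -(cardsC D).
by rewrite leq_subLR addnC leq_add2r.
Qed.
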